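(* Let $X$ be a set with $|X|\geq 2$. There exists a Hall set $\mathcal{B} \subset \mathrm{Br}(X)$ such that, for every $M \geq 1$, for every $n \in \mathbb{N}^*$ large enough, there exist $a < b \in \mathcal{B}$ with $|a| = 2$ and $|b| = n$ such that $$\| [a, b] \|_{\mathcal{B}} \geq M^n.$$
   Context: The base field is $\mathbb{K}=\mathbb{R}$ or $\mathbb{C}$; $X$ is a set (possibly infinite) with at least two elements. $\mathrm{Br}(X)$ is the free magma over $X$: the set of formal binary brackets (rooted planar binary trees with leaves labelled by elements of $X$), with product $(t_1,t_2)$. For $t\in \mathrm{Br}(X)$, $|t|$ is its number of leaves; if $t\notin X$, $t$ is written uniquely as $t=(\lambda(t),\mu(t))$. $\mathcal{L}(X)$ is the free Lie algebra over $X$ and $\mathrm{ev}:\mathrm{Br}(X)\to\mathcal{L}(X)$ is the canonical evaluation ($\mathrm{ev}(x)=x$ for $x\in X$, $\mathrm{ev}((t_1,t_2))=[\mathrm{ev}(t_1),\mathrm{ev}(t_2)]$). For $a,b\in\mathrm{Br}(X)$, $[a,b]$ denotes $[\mathrm{ev}(a),\mathrm{ev}(b)]\in\mathcal{L}(X)$. A Hall set is a subset $\mathcal{B}\subset\mathrm{Br}(X)$ endowed with a total order $<$ such that: (i) $X\subset\mathcal{B}$; (ii) for all $b_1,b_2\in\mathrm{Br}(X)$, $(b_1,b_2)\in\mathcal{B}$ iff $b_1,b_2\in\mathcal{B}$, $b_1<b_2$ and either $b_2\in X$ or $\lambda(b_2)\leq b_1$; (iii) for all $b_1,b_2\in\mathcal{B}$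 with $(b_1,b_2)\in\mathcal{B}$, $b_1<(b_1,b_2)$. By a theorem of Viennot, $\mathrm{ev}$ is injective on $\mathcal{B}$ and $\mathrm{ev}(\mathcal{B})$ is a basis of $\mathcal{L}(X)$. For $u=\sum_{c\in\mathcal{B}}\alpha_c\,\mathrm{ev}(c)\in\mathcal{L}(X)$ (finite sum), $\|u\|_{\mathcal{B}}:=\sum_{c}|\alpha_c|$. $\mathbb{N}^*$ denotes the positive integers. *)

(* Defs.v *)
From HB Require Import structures.
From mathcomp Require Import all_boot all_order all_algebra.
From mathcomp Require Import complex.
From mathcomp Require Import boolp classical_sets functions cardinality fsbigop.
From mathcomp Require Import reals.

Set Implicit Arguments.
Unset Strict Implicit.
Unset Printing Implicit Defensive.

Import Order.TTheory GRing.Theory Num.Theory.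
Local Open Scope classical_set_scope.
Local Open Scope quotient_scope.
Local Open Scope ring_scope.

(* The two admissible base fields, over an arbitrary model R of the reals. *)
Variant field_kind := RealField | ComplexField.

Definition base_field (R : realType) (k : field_kind) : numFieldType :=
  match k with RealField => R | ComplexField => R[i] end.

Inductive Br (X : Type) : Type :=
| Leaf of X
| Node of Br X & Br X.

HB.instance Definition _ (X : Type) := gen_eqMixin (Br X).
HB.instance Definition _ (X : Type) := gen_choiceMixin (Br X).

Fixpoint leaves (X : Type) (t : Br X) : nat :=
  match t with
  | Leaf _ => 1%N
  | Node t1 t2 => (leaves t1 + leaves t2)%N
  end.

HB.mixin Record isLieAlgebra (K : comNzRingType) L of GRing.Lmodule K L := {
  bracket : L -> L -> L;
  bracketDl : forall x y z, bracket (x + y) z = bracket x z + bracket y z;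
  bracketDr : forall x y z, bracket x (y + z) = bracket x y + bracket x z;
  bracketZl : forall (a : K) x y, bracket (a *: x) y = a *: bracket x y;
  bracketZr : forall (a : K) x y, bracket x (a *: y) = a *: bracket x y;
  bracketxx : forall x, bracket x x = 0;
  jacobi : forall x y z,
    bracket x (bracket y z) + bracket y (bracket z x)
      + bracket z (bracket x y) = 0
}.

#[short(type="lieAlgType")]
HB.structure Definition LieAlgebra (K : comNzRingType) :=
  {L of isLieAlgebra K L & GRing.Lmodule K L}.

(* The free Lie algebra is the quotient of the formal Lie expressions with
   variables in X by the congruence generated by the axioms of Lie algebras;
   its universal property is free_lie_univ below. *)

Inductive lie_term (K X : Type) : Type :=
| TVar of X
| TZero
| TOpp of lie_term K X
| TAdd of lie_term K X & lie_term K X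
| TScale of K & lie_term K X
| TBracket of lie_term K X & lie_term K X.

Arguments TVar {K X}.
Arguments TZero {K X}.

HB.instance Definition _ (K X : Type) := gen_eqMixin (lie_term K X).
HB.instance Definition _ (K X : Type) := gen_choiceMixin (lie_term K X).

Inductive lie_congr (K : comNzRingType) (X : Type) :
    lie_term K X -> lie_term K X -> Prop :=
| lc_refl s : lie_congr s s
| lc_sym s t : lie_congr s t -> lie_congr t s
| lc_trans s t u : lie_congr s t -> lie_congr t u -> lie_congr s u
| lc_opp s s' : lie_congr s s' -> lie_congr (TOpp s) (TOpp s')
| lc_add s s' t t' : lie_congr s s' -> lie_congr t t' ->
    lie_congr (TAdd s t) (TAdd s' t')
| lc_scale a s s' : lie_congr s s' -> lie_congr (TScale a s) (TScale a s')
| lc_bracket s s' t t' : lie_congr s s' -> lie_congr t t' ->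
    lie_congr (TBracket s t) (TBracket s' t')
| lc_addA s t u : lie_congr (TAdd s (TAdd t u)) (TAdd (TAdd s t) u)
| lc_addC s t : lie_congr (TAdd s t) (TAdd t s)
| lc_add0 s : lie_congr (TAdd TZero s) s
| lc_addN s : lie_congr (TAdd (TOpp s) s) TZero
| lc_scaleA a b s : lie_congr (TScale a (TScale b s)) (TScale (a * b) s)
| lc_scale1 s : lie_congr (TScale 1 s) s
| lc_scaleDr a s t :
    lie_congr (TScale a (TAdd s t)) (TAdd (TScale a s) (TScale a t))
| lc_scaleDl a b s :
    lie_congr (TScale (a + b) s) (TAdd (TScale a s) (TScale b s))
| lc_bracketDl s t u :
    lie_congr (TBracket (TAdd s t) u) (TAdd (TBracket s u) (TBracket t u))
| lc_bracketDr s t u :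
    lie_congr (TBracket s (TAdd t u)) (TAdd (TBracket s t) (TBracket s u))
| lc_bracketZl a s t :
    lie_congr (TBracket (TScale a s) t) (TScale a (TBracket s t))
| lc_bracketZr a s t :
    lie_congr (TBracket s (TScale a t)) (TScale a (TBracket s t))
| lc_bracketxx s : lie_congr (TBracket s s) TZero
| lc_jacobi s t u :
    lie_congr
      (TAdd (TAdd (TBracket s (TBracket t u)) (TBracket t (TBracket u s)))
            (TBracket u (TBracket s t)))
      TZero.

Definition lie_rel (K : comNzRingType) (X : Type) : rel (lie_term K X) :=
  fun s t => `[< lie_congr s t >].

Lemma lie_rel_refl (K : comNzRingType) (X : Type) : reflexive (@lie_rel K X).
Proof. by move=> s; apply/asboolP/lc_refl. Qed.

Lemma lie_rel_sym (K : comNzRingType) (X : Type) : symmetric (@lie_rel K X).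
Proof. by move=> s t; apply/asboolP/asboolP; exact: lc_sym. Qed.

Lemma lie_rel_trans (K : comNzRingType) (X : Type) :
  transitive (@lie_rel K X).
Proof.
by move=> t s u /asboolP st /asboolP tu; apply/asboolP/(lc_trans st tu).
Qed.

Canonical lie_rel_equiv (K : comNzRingType) (X : Type) :=
  EquivRel (@lie_rel K X) (@lie_rel_refl K X) (@lie_rel_sym K X)
    (@lie_rel_trans K X).

Definition free_lie (K : comNzRingType) (X : Type) :=
  {eq_quot @lie_rel K X}.

HB.instance Definition _ (K : comNzRingType) (X : Type) :=
  Choice.on (free_lie K X).
HB.instance Definition _ (K : comNzRingType) (X : Type) :=
  EqQuotient.on (free_lie K X).

Definition lie_class (K : comNzRingType) (X : Type) (s : lie_term K X) :
  free_lie K X := \pi_(free_lie K X) s.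

Definition fl_zero (K : comNzRingType) (X : Type) : free_lie K X :=
  lie_class TZero.
Definition fl_opp (K : comNzRingType) (X : Type) (u : free_lie K X) :=
  lie_class (TOpp (repr u)).
Definition fl_add (K : comNzRingType) (X : Type) (u v : free_lie K X) :=
  lie_class (TAdd (repr u) (repr v)).
Definition fl_scale (K : comNzRingType) (X : Type) (a : K)
  (u : free_lie K X) := lie_class (TScale a (repr u)).
Definition fl_bracket (K : comNzRingType) (X : Type) (u v : free_lie K X) :=
  lie_class (TBracket (repr u) (repr v)).

Lemma lie_classP (K : comNzRingType) (X : Type) (s t : lie_term K X) :
  lie_class s = lie_class t <-> lie_congr s t.
Proof.
split=> [/eqmodP/asboolP//|st].
by apply/eqmodP/asboolP.
Qed.

Lemma lie_class_surj (K : comNzRingType) (X : Type) (u : free_lie K X) :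
  exists s, u = lie_class s.
Proof. by exists (repr u); rewrite /lie_class reprK. Qed.

Lemma repr_lie_class (K : comNzRingType) (X : Type) (s : lie_term K X) :
  lie_congr (repr (lie_class s)) s.
Proof. by apply/lie_classP; rewrite /lie_class reprK. Qed.

Lemma fl_oppE (K : comNzRingType) (X : Type) (s : lie_term K X) :
  fl_opp (lie_class s) = lie_class (TOpp s).
Proof. by apply/lie_classP/lc_opp/repr_lie_class. Qed.

Lemma fl_addE (K : comNzRingType) (X : Type) (s t : lie_term K X) :
  fl_add (lie_class s) (lie_class t) = lie_class (TAdd s t).
Proof. by apply/lie_classP/lc_add; exact: repr_lie_class. Qed.

Lemma fl_scaleE (K : comNzRingType) (X : Type) (a : K) (s : lie_term K X) :
  fl_scale a (lie_class s) = lie_class (TScale a s).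
Proof. by apply/lie_classP/lc_scale/repr_lie_class. Qed.

Lemma fl_bracketE (K : comNzRingType) (X : Type) (s t : lie_term K X) :
  fl_bracket (lie_class s) (lie_class t) = lie_class (TBracket s t).
Proof. by apply/lie_classP/lc_bracket; exact: repr_lie_class. Qed.

Lemma fl_addA (K : comNzRingType) (X : Type) : associative (@fl_add K X).
Proof.
move=> u v w; have [s ->] := lie_class_surj u.
have [t ->] := lie_class_surj v; have [r ->] := lie_class_surj w.
by rewrite !fl_addE; apply/lie_classP/lc_addA.
Qed.

Lemma fl_addC (K : comNzRingType) (X : Type) : commutative (@fl_add K X).
Proof.
move=> u v; have [s ->] := lie_class_surj u; have [t ->] := lie_class_surj v.
by rewrite !fl_addE; apply/lie_classP/lc_addC.
Qed.

Lemma fl_add0 (K : comNzRingType) (X : Type) :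
  left_id (@fl_zero K X) (@fl_add K X).
Proof.
move=> u; have [s ->] := lie_class_surj u.
by rewrite fl_addE; apply/lie_classP/lc_add0.
Qed.

Lemma fl_addN (K : comNzRingType) (X : Type) :
  left_inverse (@fl_zero K X) (@fl_opp K X) (@fl_add K X).
Proof.
move=> u; have [s ->] := lie_class_surj u.
by rewrite fl_oppE fl_addE; apply/lie_classP/lc_addN.
Qed.

HB.instance Definition _ (K : comNzRingType) (X : Type) :=
  GRing.isZmodule.Build (free_lie K X) (@fl_addA K X) (@fl_addC K X)
    (@fl_add0 K X) (@fl_addN K X).

Lemma fl_scaleA (K : comNzRingType) (X : Type) (a b : K) (u : free_lie K X) :
  fl_scale a (fl_scale b u) = fl_scale (a * b) u.
Proof.
have [s ->] := lie_class_surj u.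
by rewrite !fl_scaleE; apply/lie_classP/lc_scaleA.
Qed.

Lemma fl_scale1 (K : comNzRingType) (X : Type) :
  left_id 1 (@fl_scale K X).
Proof.
move=> u; have [s ->] := lie_class_surj u.
by rewrite fl_scaleE; apply/lie_classP/lc_scale1.
Qed.

Lemma fl_scaleDr (K : comNzRingType) (X : Type) :
  right_distributive (@fl_scale K X) +%R.
Proof.
move=> a u v; have [s ->] := lie_class_surj u.
have [t ->] := lie_class_surj v.
rewrite /GRing.add /= fl_addE !fl_scaleE fl_addE.
by apply/lie_classP/lc_scaleDr.
Qed.

Lemma fl_scaleDl (K : comNzRingType) (X : Type) (u : free_lie K X) :
  {morph (fun a : K => fl_scale a u) : a b / a + b >-> a + b}.
Proof.
move=> a b; have [s ->] := lie_class_surj u.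
rewrite !fl_scaleE [RHS]fl_addE.
by apply/lie_classP/lc_scaleDl.
Qed.

HB.instance Definition _ (K : comNzRingType) (X : Type) :=
  GRing.Zmodule_isLmodule.Build K (free_lie K X) (@fl_scaleA K X)
    (@fl_scale1 K X) (@fl_scaleDr K X) (@fl_scaleDl K X).

Lemma fl_bracketDl (K : comNzRingType) (X : Type) (u v w : free_lie K X) :
  fl_bracket (u + v) w = fl_bracket u w + fl_bracket v w.
Proof.
have [s ->] := lie_class_surj u; have [t ->] := lie_class_surj v.
have [r ->] := lie_class_surj w.
rewrite /GRing.add /= fl_addE !fl_bracketE fl_addE.
by apply/lie_classP/lc_bracketDl.
Qed.

Lemma fl_bracketDr (K : comNzRingType) (X : Type) (u v w : free_lie K X) :
  fl_bracket u (v + w) = fl_bracket u v + fl_bracket u w.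
Proof.
have [s ->] := lie_class_surj u; have [t ->] := lie_class_surj v.
have [r ->] := lie_class_surj w.
rewrite /GRing.add /= fl_addE !fl_bracketE fl_addE.
by apply/lie_classP/lc_bracketDr.
Qed.

Lemma fl_bracketZl (K : comNzRingType) (X : Type) (a : K)
  (u v : free_lie K X) : fl_bracket (a *: u) v = a *: fl_bracket u v.
Proof.
have [s ->] := lie_class_surj u; have [t ->] := lie_class_surj v.
rewrite /GRing.scale /= fl_scaleE !fl_bracketE fl_scaleE.
by apply/lie_classP/lc_bracketZl.
Qed.

Lemma fl_bracketZr (K : comNzRingType) (X : Type) (a : K)
  (u v : free_lie K X) : fl_bracket u (a *: v) = a *: fl_bracket u v.
Proof.
have [s ->] := lie_class_surj u; have [t ->] := lie_class_surj v.
rewrite /GRing.scale /= fl_scaleE !fl_bracketE fl_scaleE.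
by apply/lie_classP/lc_bracketZr.
Qed.

Lemma fl_bracketxx (K : comNzRingType) (X : Type) (u : free_lie K X) :
  fl_bracket u u = 0.
Proof.
have [s ->] := lie_class_surj u.
by rewrite fl_bracketE; apply/lie_classP/lc_bracketxx.
Qed.

Lemma fl_jacobi (K : comNzRingType) (X : Type) (u v w : free_lie K X) :
  fl_bracket u (fl_bracket v w) + fl_bracket v (fl_bracket w u)
    + fl_bracket w (fl_bracket u v) = 0.
Proof.
have [s ->] := lie_class_surj u; have [t ->] := lie_class_surj v.
have [r ->] := lie_class_surj w.
rewrite /GRing.add /= !fl_bracketE !fl_addE.
by apply/lie_classP/lc_jacobi.
Qed.

HB.instance Definition _ (K : comNzRingType) (X : Type) :=
  isLieAlgebra.Build K (free_lie K X) (@fl_bracketDl K X) (@fl_bracketDr K X)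
    (@fl_bracketZl K X) (@fl_bracketZr K X) (@fl_bracketxx K X)
    (@fl_jacobi K X).

Definition gen (K : comNzRingType) (X : Type) (x : X) : free_lie K X :=
  lie_class (TVar x).

Fixpoint term_eval (K : comNzRingType) (X : Type) (L : lieAlgType K)
    (f : X -> L) (s : lie_term K X) : L :=
  match s with
  | TVar x => f x
  | TZero => 0
  | TOpp s => - term_eval f s
  | TAdd s t => term_eval f s + term_eval f t
  | TScale a s => a *: term_eval f s
  | TBracket s t => bracket (term_eval f s) (term_eval f t)
  end.

Lemma term_eval_congr (K : comNzRingType) (X : Type) (L : lieAlgType K)
    (f : X -> L) (s t : lie_term K X) :
  lie_congr s t -> term_eval f s = term_eval f t.
Proof.
elim=> /= {s t}.
- by [].
- by move=> s t _ ->.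
- by move=> s t u _ -> _ ->.
- by move=> s s' _ ->.
- by move=> s s' t t' _ -> _ ->.
- by move=> a s s' _ ->.
- by move=> s s' t t' _ -> _ ->.
- by move=> *; rewrite addrA.
- by move=> *; rewrite addrC.
- by move=> *; rewrite add0r.
- by move=> *; rewrite addNr.
- by move=> *; rewrite scalerA.
- by move=> *; rewrite scale1r.
- by move=> *; rewrite scalerDr.
- by move=> *; rewrite scalerDl.
- by move=> *; rewrite bracketDl.
- by move=> *; rewrite bracketDr.
- by move=> *; rewrite bracketZl.
- by move=> *; rewrite bracketZr.
- by move=> *; rewrite bracketxx.
- by move=> *; rewrite jacobi.
Qed.

Definition lie_morphism (K : comNzRingType) (L L' : lieAlgType K)
    (g : L -> L') : Prop :=
  linear g /\ {morph g : u v / bracket u v}.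

Lemma free_lie_univ (K : comNzRingType) (X : Type) (L : lieAlgType K)
    (f : X -> L) :
  exists! g : free_lie K X -> L,
    lie_morphism g /\ forall x, g (gen K x) = f x.
Proof.
pose g (u : free_lie K X) := term_eval f (repr u).
have gE s : g (lie_class s) = term_eval f s.
  exact/term_eval_congr/repr_lie_class.
exists g; split=> [|h [[hlin hbr] hgen]].
  split=> [|x]; last by rewrite gE.
  split=> [a u v|u v].
    have [s ->] := lie_class_surj u; have [t ->] := lie_class_surj v.
    have -> : a *: lie_class s + lie_class t
        = lie_class (TAdd (TScale a s) t).
      by rewrite /GRing.add /GRing.scale /= fl_scaleE fl_addE.
    by rewrite !gE.
  have [s ->] := lie_class_surj u; have [t ->] := lie_class_surj v.
  have -> : bracket (lie_class s) (lie_class t) = lie_class (TBracket s t).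
    by rewrite /bracket /= fl_bracketE.
  by rewrite !gE.
have h0 : h 0 = 0.
  have := hlin 1 0 0; rewrite !scale1r addr0 => /eqP.
  by rewrite -subr_eq subrr eq_sym => /eqP.
have hD u v : h (u + v) = h u + h v.
  by have := hlin 1 u v; rewrite !scale1r.
have hZ a u : h (a *: u) = a *: h u.
  by have := hlin a u 0; rewrite h0 !addr0.
apply/funext => u; have [s ->] := lie_class_surj u; rewrite gE.
elim: s => /=.
- by move=> x; rewrite -hgen.
- by rewrite -h0.
- move=> s ->; apply/eqP; rewrite eq_sym -subr_eq0 opprK -hD.
  by rewrite -fl_oppE [X in h X]addNr h0.
- by move=> s -> t ->; rewrite -hD -fl_addE.
- by move=> a s ->; rewrite -hZ -fl_scaleE.
- by move=> s -> t ->; rewrite -hbr -fl_bracketE.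
Qed.

Fixpoint ev (K : comNzRingType) (X : Type) (t : Br X) : free_lie K X :=
  match t with
  | Leaf x => gen K x
  | Node t1 t2 => bracket (ev K t1) (ev K t2)
  end.

(* In hall_set, B is the underlying set and le the (large) order, of which only
   the restriction to B matters. *)

Definition strict (T : Type) (le : T -> T -> Prop) (s t : T) : Prop :=
  le s t /\ s <> t.

Definition total_order_on (T : Type) (A : set T) (le : T -> T -> Prop) :
    Prop :=
  [/\ forall s, A s -> le s s,
      forall s t, A s -> A t -> le s t -> le t s -> s = t,
      forall s t u, A s -> A t -> A u -> le s t -> le t u -> le s u
    & total_on A le].

Definition hall_set (X : Type) (B : set (Br X)) (le : Br X -> Br X -> Prop) :
    Prop :=
  [/\ total_order_on B le,
      forall x, B (Leaf x),
      forall b1 b2, B (Node b1 b2) <->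
        [/\ B b1, B b2, strict le b1 b2
          & match b2 with
            | Leaf _ => True
            | Node lambda_b2 _ => le lambda_b2 b1
            end]
    & forall b1 b2, B b1 -> B b2 -> B (Node b1 b2) ->
        strict le b1 (Node b1 b2)].

(* alpha is a finitely supported family of coefficients, vanishing outside B,
   with u = \sum_(c in B) alpha_c ev(c). *)
Definition hall_expansion (K : comNzRingType) (X : Type) (B : set (Br X))
    (u : free_lie K X) (alpha : Br X -> K) : Prop :=
  [/\ finite_set [set c | alpha c != 0],
      [set c | alpha c != 0] `<=` B
    & u = \sum_(c \in B) alpha c *: ev K c].

(* When B is a Hall set the expansion exists and is unique (Viennot).
   For an arbitrary B, a u without expansion gets the coordinates 0. *)
Definition hall_coord (K : comNzRingType) (X : Type) (B : set (Br X))
    (u : free_lie K X) : Br X -> K :=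
  xget (fun=> 0) [set alpha | hall_expansion B u alpha].

(* The value lies in K, and is a nonnegative real element of it. *)
Definition hall_norm (K : numFieldType) (X : Type) (B : set (Br X))
    (u : free_lie K X) : K :=
  \sum_(c \in B) `|hall_coord B u c|.

(* Main.v *)
(** Any expansion of [u] on the Hall basis satisfies [|phi u| <= ||u||] as soon
    as the linear form [phi] is bounded by 1 on the basis, so only a Hall order,
    a Hall tree [b] and such a form with [phi [a, b]] large are needed.

    Fix letters [x <> y] and put [a = (x, y)], [p = (x, (x, y))],
    [q = (x, (x, (x, y)))], [h = (p, q)], [z' = (a, y)].  The order puts [x] first, then
    [a], then the trees with leftmost leaf [y], then the other ones, those that
    contain [z'] being the largest.  Hence [b = (..((y, q), .. q), p), .. p)],
    with [i] letters [q] and [l <= i] letters [p], is a Hall tree, and [ad_a]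
    replaces its leaf [y] by [z'], up to brackets killed by [phi].  Once [z'] is large, the
    Hall trees containing it look like a decreasing product, in the enveloping
    algebra, applied to [z']; so [[a, b]] amounts to a word [p^l q^i] to be put
    in normal order.  Letting [p] and [q] act on polynomials in [t] as [d/dt]
    and [t], and [z'] be the vector 1, the Hall trees give monomials [t^m] or 0
    whereas [[a, b]] gives [+/- (d/dt)^l t^i].  Evaluating at [t = 1], [phi [a, b]]
    is at least [l!] in absolute value, with [|b| = 1 + 4 i + 3 l].

    The representation is induced twice, from the elimination of [x] and then
    from that of [a], each of which acts as a shift of sequences. *)

From HB Require Import structures.
Require Import Defs.
From mathcomp Require Import all_boot all_order all_algebra.
From mathcomp Require Import complex.
From mathcomp Require Import boolp classical_sets cardinality fsbigop functions.
From mathcomp Require Import reals.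
From mathcomp Require wochoice.
From mathcomp Require Import zify.

Set Implicit Arguments.
Unset Strict Implicit.
Unset Printing Implicit Defensive.

Import Order.TTheory GRing.Theory Num.Theory.
Local Open Scope ring_scope.

(** * Hall bases span *)

Section LieAlgebra.
Variables (K : comNzRingType) (L : lieAlgType K).
Implicit Types u v w : L.

Lemma bracket0l v : bracket 0 v = 0 :> L.
Proof. by have := bracketZl 0 0 v; rewrite !scale0r. Qed.

Lemma bracketC u v : bracket u v = - bracket v u.
Proof.
apply/eqP; rewrite -addr_eq0; apply/eqP.
have := bracketxx (u + v); rewrite bracketDl !bracketDr !bracketxx.
by rewrite add0r addr0.
Qed.

Lemma bracketNr u v : bracket u (- v) = - bracket u v.
Proof. by rewrite -!scaleN1r bracketZr. Qed.

Lemma bracket_bracketr u v w :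
  bracket u (bracket v w) = bracket (bracket u v) w + bracket v (bracket u w).
Proof.
apply/eqP; rewrite -subr_eq0 -[X in _ == X](jacobi u v w); apply/eqP.
by rewrite (bracketC w (bracket u v)) (bracketC w u) bracketNr opprD addrA addrAC.
Qed.

End LieAlgebra.

Section HallSpan.
Variables (K : comNzRingType) (X : Type).
Implicit Types (P Q : Br X -> Prop) (a b c : Br X) (u v : free_lie K X).

Inductive ev_span P : free_lie K X -> Prop :=
| ev_span0 : ev_span P 0
| ev_spanZD (k : K) c u : P c -> ev_span P u -> ev_span P (k *: ev K c + u).

Lemma ev_span_ev P c : P c -> ev_span P (ev K c).
Proof.
move=> Pc; rewrite -[ev K c]addr0 -[ev K c]scale1r.
by apply: ev_spanZD => //; exact: ev_span0.
Qed.

Lemma ev_spanD P u v : ev_span P u -> ev_span P v -> ev_span P (u + v).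
Proof.
move=> + Pv; elim=> [|k c w Pc _ IH]; first by rewrite add0r.
by rewrite -addrA; exact: ev_spanZD.
Qed.

Lemma ev_spanZ P (k : K) u : ev_span P u -> ev_span P (k *: u).
Proof.
elim=> [|l c w Pc _ IH]; first by rewrite scaler0; exact: ev_span0.
by rewrite scalerDr scalerA; exact: ev_spanZD.
Qed.

Lemma ev_spanN P u : ev_span P u -> ev_span P (- u).
Proof. by rewrite -scaleN1r; exact: ev_spanZ. Qed.

Lemma sub_ev_span P Q u : (forall c, P c -> Q c) -> ev_span P u -> ev_span Q u.
Proof.
move=> PQ; elim=> [|k c w Pc _ IH]; first exact: ev_span0.
by apply: ev_spanZD => //; exact: PQ.
Qed.

Lemma ev_span_bracketl P Q u v :
  (forall c, P c -> ev_span Q (bracket (ev K c) v)) ->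
  ev_span P u -> ev_span Q (bracket u v).
Proof.
move=> PQ; elim=> [|k c w Pc _ IH]; first by rewrite bracket0l; exact: ev_span0.
by rewrite bracketDl bracketZl; apply: ev_spanD => //; apply: ev_spanZ; exact: PQ.
Qed.

(** Letters are kept as trees, since [Br X] has a decidable equality and [X] is a bare type. *)
Fixpoint leaf_seq a : seq (Br X) :=
  match a with Leaf x => [:: Leaf x] | Node a1 a2 => leaf_seq a1 ++ leaf_seq a2 end.

Definition leaves_in (F : seq (Br X)) a := {subset leaf_seq a <= F}.

Lemma leaves_inN F a b :
  leaves_in F (Node a b) <-> leaves_in F a /\ leaves_in F b.
Proof.
split=> [Fab|[Fa Fb] x]; last by rewrite mem_cat => /orP[/Fa|/Fb].
by split=> x xa; apply: Fab; rewrite mem_cat xa ?orbT.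
Qed.

(** A finite list with all trees of at most [n] leaves in [F], even for infinite [X]; counting in it
    gives the rewriting below a terminating measure. *)
Fixpoint trees (F : seq (Br X)) n : seq (Br X) :=
  if n is n'.+1 then F ++ [seq Node a b | a <- trees F n', b <- trees F n'] else [::].

Lemma leaves_gt0 a : (0 < leaves a)%N.
Proof. by elim: a => //= a Ha b _; rewrite addn_gt0 Ha. Qed.

Lemma mem_trees F n a : leaves_in F a -> (leaves a <= n)%N -> a \in trees F n.
Proof.
elim: a n => [x|a IHa b IHb] n.
  by case: n => // n Fx _; rewrite /= mem_cat Fx ?inE.
move/leaves_inN=> [Fa Fb]; have := leaves_gt0 a; have := leaves_gt0 b.
case: n => /= [|n] ? ? ?; first by lia.
rewrite mem_cat; apply/orP; right; apply/allpairsP; exists (a, b).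
by split=> //=; [apply: IHa | apply: IHb] => //; lia.
Qed.

Lemma ltn_count (T : eqType) (p q : pred T) (s : seq T) x :
  subpred p q -> x \in s -> q x -> ~~ p x -> (count p s < count q s)%N.
Proof.
move=> pq; elim: s => //= y s IH; rewrite inE => /predU1P[<- qx /negPf px|xs qx px].
  by rewrite qx px add0n add1n ltnS sub_count.
have := IH xs qx px; have := @pq y; case: (p y); case: (q y) => //= H; lia.
Qed.

Section Rewriting.
Variables (B : set (Br X)) (le : Br X -> Br X -> Prop) (hB : hall_set B le).
Variables (F : seq (Br X)) (n0 : nat).

Let lexx a : B a -> le a a. Proof. by case: hB => -[+ _ _ _] _ _ _; exact. Qed.
Let le_anti a b : B a -> B b -> le a b -> le b a -> a = b.
Proof. by case: hB => -[_ + _ _] _ _ _; exact. Qed.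
Let le_tr b a c : B a -> B b -> B c -> le a b -> le b c -> le a c.
Proof. by move=> Ba Bb Bc; case: hB => -[_ _ + _] _ _ _; exact. Qed.
Let le_total a b : B a -> B b -> le a b \/ le b a.
Proof. by case: hB => -[_ _ _ +] _ _ _; exact. Qed.

Lemma hall_lt_le_trans a b c :
  B a -> B b -> B c -> strict le a b -> le b c -> strict le a c.
Proof.
move=> Ba Bb Bc [ab nab] bc; split; first exact: (le_tr Ba Bb Bc).
by move=> ac; apply: nab; apply: le_anti => //; rewrite ac.
Qed.

Lemma hall_le_lt_trans a b c :
  B a -> B b -> B c -> le a b -> strict le b c -> strict le a c.
Proof.
move=> Ba Bb Bc ab [bc nbc]; split; first exact: (le_tr Ba Bb Bc).
by move=> ac; apply: nbc; apply: le_anti => //; rewrite -ac.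
Qed.

Definition above a : pred (Br X) := fun t => `[< B t /\ strict le a t >].

Lemma ltn_count_above a b : B a -> B b -> strict le a b -> leaves_in F b ->
  (leaves b <= n0)%N ->
  (count (above b) (trees F n0) < count (above a) (trees F n0))%N.
Proof.
move=> Ba Bb ab Fb bn; apply: (ltn_count (x := b)).
- move=> t /asboolP[Bt bt]; apply/asboolP; split=> //.
  by apply: (hall_lt_le_trans Ba Bb) => //; case: bt.
- exact: mem_trees.
- exact/asboolP.
- by apply/asboolP => -[_ []].
Qed.

(* Besides [B c], this records what the rewriting of a bracket of two Hall
   trees bounded below by [z] preserves; [z <= lambda c < c] makes the infimum
   of the two factors increase at each step. *)
Definition hall_above (z : Br X) (d : nat) c :=
  [/\ B c, leaves_in F c, (leaves c <= d)%N &
     match c with Leaf _ => False | Node c1 _ => le z c1 end].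

Lemma hall_above_lt z d c : B z -> hall_above z d c -> strict le z c.
Proof.
case: hB => _ _ Bnode lt_node; case: c => [x|c1 c2] Bz [Bc _ _ zc] //.
have [Bc1 Bc2 _ _] := (Bnode _ _).1 Bc.
by apply: (@hall_le_lt_trans z c1) => //; exact: lt_node.
Qed.

(** Induction on the number of leaves, then on the number of Hall trees above [a]. If [(a, b)] is
    not Hall, then [b = (b1, b2)] with [a < b1 < b2]. Jacobi leaves [[[a, b1], b2]] and [[[a, b2],
    b1]]; the inner brackets have fewer leaves and expand on trees above [a], so both outer factors
    lie above [a]. *)
Lemma ev_span_bracket_lt d m a b : B a -> B b -> strict le a b ->
  leaves_in F a -> leaves_in F b -> (leaves a + leaves b <= d)%N -> (d <= n0)%N ->
  (count (above a) (trees F n0) <= m)%N ->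
  ev_span (hall_above a d) (bracket (ev K a) (ev K b)).
Proof.
elim/ltn_ind: d m a b => d IHd; elim=> [|m IHm] a b Ba Bb ab Fa Fb dab dn am.
  (* The tree [b] itself lies above [a], so the count is not 0. *)
  by have := ltn_count_above Ba Bb ab Fb; have := leaves_gt0 a; lia.
case: (hB) => _ _ Bnode lt_node.
have [hb|] := pselect (match b with Leaf _ => True | Node l _ => le l a end).
  have Bab : B (Node a b) by apply/Bnode.
  by apply: (@ev_span_ev _ (Node a b)); split=> //; [exact/leaves_inN | exact: lexx].
(* Of two distinct factors above [a], the smaller has fewer trees above it than [a] has. *)
have IHm' (u v : Br X) : B u -> B v -> strict le a u -> strict le a v -> leaves_in F u ->
    leaves_in F v -> (leaves u + leaves v <= d)%N ->
    ev_span (hall_above a d) (bracket (ev K u) (ev K v)).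
  have lt (u' v' : Br X) : B u' -> B v' -> strict le a u' ->
      leaves_in F u' -> leaves_in F v' ->
      (leaves u' + leaves v' <= d)%N -> strict le u' v' ->
      ev_span (hall_above a d) (bracket (ev K u') (ev K v')).
    move=> Bu' Bv' au' Fu' Fv' duv' uv'.
    apply: (@sub_ev_span (hall_above u' d)).
      move=> [x|c1 c2] [// Bc Fc dc uc]; split=> //.
      have [Bc1 _ _ _] := (Bnode _ _).1 Bc.
      by apply: (le_tr Ba Bu' Bc1) => //; case: au'.
    apply: IHm => //; rewrite -ltnS; apply: leq_trans am.
    by apply: ltn_count_above => //; lia.
  move=> Bu Bv au av Fu Fv duv.
  have [<-|nuv] := pselect (u = v); first by rewrite bracketxx; exact: ev_span0.
  have [uv|vu] := le_total Bu Bv; first exact: lt.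
  by rewrite bracketC; apply: ev_spanN; apply: lt; rewrite // 1?addnC //; split=> // /esym.
case: b Bb ab Fb dab => [//|b1 b2] Bb ab Fb /= dab nb1a.
have [Bb1 Bb2 b12 _] := (Bnode _ _).1 Bb.
have [Fb1 Fb2] := (leaves_inN _ _ _).1 Fb.
have ab1 : strict le a b1.
  split; first by case: (le_total Ba Bb1).
  by move=> ab1; apply: nb1a; rewrite -ab1; exact: lexx.
have ab2 : strict le a b2 by apply: (hall_lt_le_trans Ba Bb1 Bb2 ab1); case: b12.
have ? := leaves_gt0 b1; have ? := leaves_gt0 b2.
have nested (b' v : Br X) : B b' -> B v -> strict le a b' -> strict le a v ->
    leaves_in F b' -> leaves_in F v -> (leaves a + leaves b' + leaves v <= d)%N ->
    ev_span (hall_above a d) (bracket (bracket (ev K a) (ev K b')) (ev K v)).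
  move=> Bb' Bv ab' av Fb' Fv dv.
  apply: (@ev_span_bracketl (hall_above a (leaves a + leaves b'))).
    move=> c hc; have ac := hall_above_lt Ba hc; case: hc => Bc Fc dc _.
    by apply: IHm' => //; lia.
  have := leaves_gt0 v => ?.
  by apply: (IHd _ _ (count (above a) (trees F n0))) => //; lia.
rewrite /= bracket_bracketr [bracket (ev K b1) _]bracketC.
by apply: ev_spanD; [|apply: ev_spanN]; apply: nested => //; lia.
Qed.
End Rewriting.

Lemma hall_span_bracket (B : set (Br X)) le a b : hall_set B le ->
  B a -> B b -> strict le a b -> ev_span B (bracket (ev K a) (ev K b)).
Proof.
move=> hB Ba Bb ab; pose F := leaf_seq a ++ leaf_seq b; pose d := (leaves a + leaves b)%N.
apply: (@sub_ev_span (hall_above B le F a d)) => [c []//|].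
by apply: (ev_span_bracket_lt (n0 := d) (m := count (above B le a) (trees F d)) hB);
  rewrite ?leqnn // => x xab; rewrite mem_cat xab ?orbT.
Qed.

Lemma hall_expansion_span (B : set (Br X)) u :
  ev_span B u -> exists alpha, hall_expansion B u alpha.
Proof.
move=> Bu.
suff [alpha [r [ur rB alpha0 ->]]] : exists (alpha : Br X -> K) r,
    [/\ uniq r, forall c, c \in r -> B c, forall c, c \notin r -> alpha c = 0
      & u = \sum_(c <- r) alpha c *: ev K c].
  have sub : ([set c | alpha c != 0] `<=` [set` r])%classic.
    by move=> c /=; apply: contraNT => /alpha0 ->.
  exists alpha; split.
  - exact: (sub_finite_set sub).
  - by move=> c /sub /rB.
  rewrite (fsbigE r) //.
  - rewrite [RHS]big_mkcond /= big_seq [RHS]big_seq; apply: eq_bigr => c /rB Bc.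
    by rewrite mem_set.
  - by move=> c _ /alpha0 ->; rewrite scale0r.
elim: Bu => [|k c w Bc _ [alpha [r [ur rB alpha0 ->]]]].
  by exists (fun=> 0), [::]; split=> //; rewrite big_nil.
exists (fun t => (if t == c then k else 0) + alpha t), (undup (c :: r)); split.
- exact: undup_uniq.
- by move=> t; rewrite mem_undup inE => /predU1P[->|/rB].
- move=> t; rewrite mem_undup inE negb_or => /andP[/negPf -> /alpha0 ->].
  by rewrite addr0.
under [RHS]eq_bigr => t _ do rewrite scalerDl.
rewrite big_split /=; congr (_ + _).
  have cr : c \in undup (c :: r) by rewrite mem_undup mem_head.
  rewrite (bigD1_seq c cr (undup_uniq _)) eqxx big1 /= ?addr0 //.
  by move=> t /negPf ->; rewrite scale0r.
rewrite /=; case: ifP => [cr|/negbT cr]; rewrite undup_id //.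
by rewrite big_cons alpha0 // scale0r add0r.
Qed.

End HallSpan.

(** [hall_coord] is an expansion of [u] once one exists; the triangle inequality applies to it. *)
Lemma le_hall_norm (K : numFieldType) (X : Type) (B : set (Br X))
    (phi : free_lie K X -> K) (u : free_lie K X) :
  (forall v w, phi (v + w) = phi v + phi w) ->
  (forall k v, phi (k *: v) = k * phi v) ->
  (forall c, B c -> `|phi (ev K c)| <= 1) ->
  ev_span B u -> `|phi u| <= hall_norm B u.
Proof.
move=> phiD phiZ phi1 /hall_expansion_span/xgetPex -/(_ (fun=> 0)).
rewrite -[xget _ _]/(hall_coord B u) /hall_norm.
set alpha := hall_coord B u => -[fin sub uE].
have [s sE] := (finite_seqP _).1 fin; pose r := undup s.
have rE c : (c \in r) = (alpha c != 0).
  have := congr1 (@^~ c) sE => /= cE.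
  by rewrite mem_undup; apply/idP/idP; [rewrite -cE | rewrite cE].
have alpha0 c : c \notin r -> alpha c = 0 by rewrite rE negbK => /eqP.
have rB c : c \in r -> B c by rewrite rE => /sub.
have sumr (V : zmodType) (f : Br X -> V) : (forall c, c \notin r -> f c = 0) ->
    \sum_(c \in B) f c = \sum_(c <- r) f c.
  move=> f0; rewrite (fsbigE r) //; [|exact: undup_uniq|by move=> c _ /f0].
  rewrite [LHS]big_mkcond /= big_seq [RHS]big_seq; apply: eq_bigr => c /rB Bc.
  by rewrite mem_set.
rewrite uE !sumr; try by move=> c /alpha0 ->; rewrite ?normr0 ?scale0r.
have phi0 : phi 0 = 0 by rewrite -(scale0r 0) phiZ mul0r.
rewrite (big_morph phi phiD phi0); apply: le_trans (ler_norm_sum _ _ _) _.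
rewrite big_seq [leRHS]big_seq; apply: ler_sum => c /rB /phi1 c1.
by rewrite phiZ normrM ler_piMr.
Qed.

(** * Representations of the free Lie algebra *)

Section Representation.
Variables (K : comNzRingType) (X : Type) (V : lmodType K) (f : X -> V -> V).
Hypothesis f_linear : forall x, linear (f x).

Fixpoint rep_term (s : lie_term K X) : V -> V :=
  match s with
  | TVar x => f x
  | TZero => fun=> 0
  | TOpp s => fun v => - rep_term s v
  | TAdd s t => fun v => rep_term s v + rep_term t v
  | TScale k s => fun v => k *: rep_term s v
  | TBracket s t =>
      fun v => rep_term s (rep_term t v) - rep_term t (rep_term s v)
  end.

Lemma rep_term_linear s : linear (rep_term s).
Proof.
elim: s => [x||s IHs|s IHs t IHt|l s IHs|s IHs t IHt] /= k u v.
- exact: f_linear.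
- by rewrite scaler0 addr0.
- by rewrite IHs opprD scalerN.
- by rewrite IHs IHt scalerDr addrACA.
- by rewrite IHs scalerDr !scalerA mulrC.
- by rewrite IHs IHt IHt IHs scalerBr opprD addrACA.
Qed.

HB.instance Definition _ s :=
  GRing.isLinear.Build K V V *:%R (rep_term s) (rep_term_linear s).

Lemma rep_term_congr s t : lie_congr s t -> rep_term s =1 rep_term t.
Proof.
elim=> {s t} /=.
- by [].
- by move=> s t _ IH v; rewrite IH.
- by move=> s t u _ IH _ IH' v; rewrite IH.
- by move=> s s' _ IH v; rewrite IH.
- by move=> s s' t t' _ IH _ IH' v; rewrite IH IH'.
- by move=> a s s' _ IH v; rewrite IH.
- by move=> s s' t t' _ IH _ IH' v; rewrite !IH !IH'.
- by move=> s t u v; rewrite addrA.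
- by move=> s t v; rewrite addrC.
- by move=> s v; rewrite add0r.
- by move=> s v; rewrite addNr.
- by move=> k l s v; rewrite scalerA.
- by move=> s v; rewrite scale1r.
- by move=> k s t v; rewrite scalerDr.
- by move=> k l s v; rewrite scalerDl.
- by move=> s t u v; rewrite linearD opprD addrACA.
- by move=> s t u v; rewrite linearD opprD addrACA.
- by move=> a s t v; rewrite linearZ scalerBr.
- by move=> a s t v; rewrite linearZ scalerBr.
- by move=> s v; rewrite subrr.
- move=> s t u v; rewrite /= !opprB !linearB /=.
  rewrite [rep_term s (rep_term t _) - _ + _]addrC [X in X + _]addrACA !subrKA.
  by rewrite [rep_term u _ - _ + _]addrC addrACA !subrKA subrr.
Qed.

Definition rep (u : free_lie K X) : V -> V := rep_term (repr u).

Lemma rep_class s v : rep (lie_class s) v = rep_term s v.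
Proof. by apply: rep_term_congr; exact: repr_lie_class. Qed.

Lemma repD u w v : rep (u + w) v = rep u v + rep w v.
Proof. by rewrite /GRing.add /= /fl_add rep_class. Qed.

Lemma repZ k u v : rep (k *: u) v = k *: rep u v.
Proof. by rewrite {1}/GRing.scale /= /fl_scale rep_class. Qed.

Lemma rep_bracket u w v : rep (bracket u w) v = rep u (rep w v) - rep w (rep u v).
Proof. by rewrite /bracket /= /fl_bracket rep_class. Qed.

Lemma rep_gen x v : rep (gen K x) v = f x v.
Proof. exact: rep_class. Qed.

End Representation.

(* In the divided powers [t^[i] = t^i / i!], [leib n] is multiplication by
   [\sum_m n_m t^[m]] and [f |-> (f \o S)] is d/dt. *)
Definition leib (V : zmodType) (n : nat -> V -> V) (f : nat -> V) (i : nat) : V :=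
  \sum_(m < i.+1) n m (f (i - m)%N) *+ 'C(i, m).

(** The Leibniz rule, by Pascal's identity: the commutator of the shift with [leib n] is
    [leib (n \o succn)], so a bracket with an eliminated letter shifts [n]. *)
Lemma leibS (V : zmodType) (n : nat -> V -> V) (f : nat -> V) i :
  leib n f i.+1 = leib (n \o succn) f i + leib n (f \o succn) i.
Proof.
rewrite /leib big_ord_recl /= bin0 subn0.
under eq_bigr => m _ do rewrite /= /bump leq0n add1n subSS binS mulrnDr.
rewrite big_split /= addrA addrC; congr (_ + _).
rewrite [RHS]big_ord_recl /= bin0 subn0; congr (_ + _).
rewrite big_ord_recr /= bin_small // mulr0n addr0; apply: eq_bigr => m _.
by rewrite /bump leq0n add1n subnSK.
Qed.

Lemma leib0 (V : zmodType) (n : nat -> V -> V) f : leib n f 0 = n 0%N (f 0%N).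
Proof. by rewrite /leib big_ord1 subn0 bin0. Qed.

Lemma leib_linear (K : comNzRingType) (V : lmodType K) (n : nat -> V -> V) :
  (forall m, linear (n m)) -> linear (leib n).
Proof.
move=> nlin k f g; apply/funext => i.
rewrite -[RHS]/(k *: leib n f i + leib n g i) /leib scaler_sumr -big_split /=.
by apply: eq_bigr => m _; rewrite [n m _]nlin mulrnDl scalerMnr.
Qed.

(** * The Hall set *)

Lemma total_order_exists (T : eqType) :
  exists R : rel T, [/\ total R, antisymmetric R & transitive R].
Proof.
have [R Rwo] := wochoice.well_ordering_principle T.
have chR : wochoice.wo_chain R predT by apply: wochoice.withinW.
have tot x y : R x y || R y x by exact: (wochoice.wo_chainW chR).
have anti x y : R x y -> R y x -> x = y.
  by move=> xy yx; apply: (wochoice.wo_chain_antisymmetric chR); rewrite ?xy.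
exists R; split=> //; first by move=> x y /andP[]; exact: anti.
move=> y x z xy yz.
(* Transitivity is read off from the least element of [{x, y, z}]. *)
have [|m [[]]] := Rwo [pred t | t \in [:: x; y; z]]; first by exists x; rewrite !inE eqxx.
rewrite !inE => mxyz mmin _.
have m_le t : t \in [:: x; y; z] -> R m t by move=> ?; apply: mmin.
case/or3P: mxyz => /eqP mE; subst m.
- by apply: m_le; rewrite !inE eqxx !orbT.
- by rewrite (anti _ _ xy) //; apply: m_le; rewrite !inE eqxx.
- by rewrite -(anti _ _ yz) //; apply: m_le; rewrite !inE eqxx orbT.
Qed.

Section HallOfOrder.
Variables (X : Type) (le : rel (Br X)).

Fixpoint hall_trees (t : Br X) : Prop :=
  match t with
  | Leaf _ => True
  | Node b1 b2 => [/\ hall_trees b1, hall_trees b2, strict le b1 b2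
      & match b2 with Leaf _ => True | Node l _ => le l b1 end]
  end.

Lemma hall_set_of_order :
  total le -> antisymmetric le -> transitive le ->
  (forall t1 t2, strict le t1 (Node t1 t2)) -> hall_set hall_trees le.
Proof.
move=> tot anti tr lt_node; split=> //; split.
- by move=> s _; have := tot s s; rewrite orbb.
- by move=> s t _ _ st ts; apply: anti; rewrite st.
- by move=> s t u _ _ _; exact: tr.
- by move=> s t _ _; apply/orP.
Qed.

End HallOfOrder.

Section KeyOrder.
Variables (X : Type) (x y : X).
Hypothesis xy : x <> y.
Variable wo : rel (Br X).
Hypotheses (wo_total : total wo) (wo_anti : antisymmetric wo)
  (wo_trans : transitive wo).
Implicit Types s t c : Br X.

Definition adx (k : nat) (v : X) : Br X := iter k (Node (Leaf x)) (Leaf v).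
Definition ta : Br X := adx 1 y.
Definition tp : Br X := adx 2 y.
Definition tq : Br X := adx 3 y.
Definition th : Br X := Node tp tq.
Definition tz : Br X := Node ta (Leaf y).

(** The level in the order: 0 is [x], 1 is [ta], 2 means leftmost leaf [y]; otherwise 4 is inherited
    from [tz] through either factor. *)
Fixpoint key t : nat :=
  match t with
  | Leaf v => (if Leaf v == Leaf x then 0 else if Leaf v == Leaf y then 2 else 3)%N
  | Node t1 t2 =>
      (if Node t1 t2 == ta then 1
       else if key t1 == 2 then 2
       else if [|| Node t1 t2 == tz, key t1 == 4 | key t2 == 4] then 4 else 3)%N
  end.

(** Within a level the size decides first, which puts a tree above its left factor and gives
    [tp < tq < th]. *)
Definition tle s t : bool :=
  ((key s < key t) || ((key s == key t) &&
    ((leaves s < leaves t) || ((leaves s == leaves t) && wo s t))))%N.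

Lemma tle_total : total tle.
Proof.
move=> s t; rewrite /tle; have := wo_total s t.
by case: ssrnat.ltngtP; case: ssrnat.ltngtP.
Qed.

Lemma tle_anti : antisymmetric tle.
Proof.
move=> s t; rewrite /tle; have := @wo_anti s t.
by case: ssrnat.ltngtP; case: ssrnat.ltngtP.
Qed.

Lemma tle_trans : transitive tle.
Proof.
move=> t s u; rewrite /tle.
move=> /orP[st|/andP[/eqP -> st]] /orP[tu|/andP[/eqP <- tu]].
- by rewrite (ltn_trans st tu).
- by rewrite st.
- by rewrite tu.
rewrite eqxx /=; apply/orP; right; case/orP: st => [st|/andP[/eqP -> st]].
  case/orP: tu => [tu|/andP[/eqP <- _]]; first by rewrite (ltn_trans st tu).
  by rewrite st.
case/orP: tu => [->//|/andP[-> tu]] /=.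
by rewrite (wo_trans st tu) orbT.
Qed.

Lemma tle_key s t : tle s t -> (key s <= key t)%N.
Proof. by rewrite /tle; case: ssrnat.ltngtP. Qed.

Lemma key_lt s t : (key s < key t)%N -> strict tle s t.
Proof. by move=> st; split; [rewrite /tle st | move=> E; move: st; rewrite E ltnn]. Qed.

Lemma neq_leaves s t : leaves s != leaves t -> (s == t) = false.
Proof. by apply: contraNF => /eqP ->. Qed.

Lemma neq_xy : (Leaf y == Leaf x) = false.
Proof. by apply/eqP => -[/esym]. Qed.

Lemma key_le4 t : (key t <= 4)%N.
Proof. by case: t => [v|t1 t2] /=; repeat case: ifP. Qed.

Lemma key_x t : key t = 0%N -> t = Leaf x.
Proof. by case: t => [v|t1 t2] /=; do ?case: ifP => // /eqP. Qed.

Lemma key_a t : key t = 1%N -> t = ta.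
Proof. by case: t => [v|t1 t2] /=; do ?case: ifP => // /eqP. Qed.

Lemma key_Lx : key (Leaf x) = 0%N.
Proof. by rewrite /= eqxx. Qed.

Lemma key_Ly : key (Leaf y) = 2%N.
Proof. by rewrite /= neq_xy eqxx. Qed.

Lemma keyN t1 t2 : key (Node t1 t2) =
  (if Node t1 t2 == ta then 1
   else if key t1 == 2 then 2
   else if [|| Node t1 t2 == tz, key t1 == 4 | key t2 == 4] then 4 else 3)%N.
Proof. by []. Qed.

#[local] Arguments key : simpl never.

Lemma key_ta : key ta = 1%N.
Proof. by rewrite keyN eqxx. Qed.

Lemma key_tp : key tp = 3%N.
Proof. by rewrite keyN key_Lx key_ta neq_leaves //=; case: eqP. Qed.

Lemma key_tq : key tq = 3%N.
Proof. by rewrite keyN key_Lx key_tp !neq_leaves. Qed.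

Lemma key_th : key th = 3%N.
Proof. by rewrite keyN key_tp key_tq !neq_leaves. Qed.

Lemma key_tz : key tz = 4%N.
Proof. by rewrite keyN key_ta eqxx neq_leaves. Qed.

Lemma key_node t1 t2 : (key t1 <= key (Node t1 t2))%N.
Proof.
rewrite keyN; case: eqP => [[-> _]|_]; first by rewrite key_Lx.
case: eqP => [->//|_]; case: ifP; first by rewrite key_le4.
by move=> /norP[_ /norP[n4 _]]; have := key_le4 t1; lia.
Qed.

Lemma tle_node t1 t2 : strict tle t1 (Node t1 t2).
Proof.
split; last by move/(congr1 (@leaves X)) => /=; have := leaves_gt0 t2; lia.
rewrite /tle; have := key_node t1 t2; rewrite leq_eqVlt => /orP[/eqP ->|->//].
by rewrite eqxx ltnn /= -[X in (X < _)%N]addn0 ltn_add2l leaves_gt0.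
Qed.

Local Notation B := (hall_trees tle).

Lemma hall_B : hall_set B tle.
Proof. exact: (hall_set_of_order tle_total tle_anti tle_trans tle_node). Qed.

Lemma key_neq_xa c : c <> Leaf x -> c <> ta -> (1 < key c)%N.
Proof.
move=> cx ca; have k0 : key c <> 0%N by move/key_x.
have k1 : key c <> 1%N by move/key_a.
by lia.
Qed.

(** As [x] is least, the Hall condition on [(x, c)] forces the left factor of [c] to be [x]
    again. *)
Lemma adx_hall c : B c -> c <> Leaf x ->
  match c with Leaf _ => True | Node l _ => l = Leaf x end ->
  exists k v, c = adx k v /\ v <> x.
Proof.
elim: c => [v|l _ c IH] /=.
  by move=> _ vx _; exists 0%N, v; split=> // E; apply: vx; rewrite E.
move=> [_ Bc xc cl] _ lx; subst l.
have cx : c <> Leaf x by move=> E; case: xc => _; rewrite E.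
have [|k [v [-> vx]]] := IH Bc cx; last by exists k.+1, v.
case: c cl {xc IH Bc cx} => // l r /tle_key; rewrite key_Lx leqn0 => /eqP.
exact: key_x.
Qed.

Definition ada (j k : nat) (v : X) : Br X := iter j (Node ta) (adx k v).

(** Same argument for [ta], the second least tree: the left factor of [c] in [(ta, c)] is [x] or
    [ta]. The excluded [adx 1 y] is [ta]. *)
Lemma ada_hall c : B c -> c <> Leaf x -> c <> ta ->
  match c with Leaf _ => True | Node l _ => l = Leaf x \/ l = ta end ->
  exists j k v, [/\ c = ada j k v, v <> x & ~ (v = y /\ k = 1%N)].
Proof.
elim: c => [v|l _ c IH].
  by move=> _ vx _ _; exists 0%N, 0%N, v; split=> // [E|[]] //; apply: vx; rewrite E.
move=> Bc cx ca [lx|la].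
  have [k [v [E vx]]] := adx_hall Bc cx lx.
  by exists 0%N, k, v; split=> // -[vy k1]; apply: ca; rewrite E vy k1.
subst l; case: Bc => _ Bc ac cl.
have c1 : (1 < key c)%N.
  have [/tle_key + nac] := ac; rewrite key_ta leq_eqVlt => /orP[/eqP/esym/key_a|//].
  by move/esym/nac.
have {}cx : c <> Leaf x by move=> E; rewrite E key_Lx in c1.
have {}ca : c <> ta by move=> E; rewrite E key_ta in c1.
have [|j [k [v [-> vx vk]]]] := IH Bc cx ca; last by exists j.+1, k, v.
case: c cl {IH Bc ac c1 cx ca} => // l r /tle_key; rewrite key_ta.
by rewrite leq_eqVlt ltnS leqn0 => /orP[/eqP/key_a|/eqP/key_x]; [right|left].
Qed.

Definition word (i l : nat) : Br X :=
  iter l (fun w => Node w tp) (iter i (fun w => Node w tq) (Leaf y)).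

Lemma B_adx k : B (adx k y).
Proof.
elim: k => [//|k IH]; split=> //.
  have lt : (0 < key (adx k y))%N.
    by case: k {IH} => [|k]; [rewrite key_Ly | rewrite lt0n; apply/eqP => /key_x].
  by apply: key_lt; rewrite key_Lx.
by case: k {IH} => // k; have := tle_total (Leaf x) (Leaf x); rewrite orbb.
Qed.

(** Leftmost leaf [y] keeps the words at level 2, between [x], the left factor of [tp] and [tq], and
    level 3, where these two lie. *)
Lemma word_hall i l : B (word i l) /\ key (word i l) = 2%N.
Proof.
have ext w c : B w -> key w = 2%N -> B (Node (Leaf x) c) -> key (Node (Leaf x) c) = 3%N ->
    B (Node w (Node (Leaf x) c)) /\ key (Node w (Node (Leaf x) c)) = 2%N.
  move=> Bw kw Bc kc; split; last first.
    by rewrite keyN kw eqxx; case: eqP.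
  split=> //; first by apply: key_lt; rewrite kw kc.
  by have [] : strict tle (Leaf x) w by apply: key_lt; rewrite kw key_Lx.
elim: l => [|l [IH1 IH2]]; last by apply: ext => //; [exact: (B_adx 2) | exact: key_tp].
elim: i => [|i [IH1 IH2]]; first by split=> //; rewrite key_Ly.
by apply: ext => //; [exact: (B_adx 3) | exact: key_tq].
Qed.

Lemma leaves_word i l : leaves (word i l) = (1 + 4 * i + 3 * l)%N.
Proof.
by elim: l => /= [|l ->]; last lia; elim: i => //= i ->; lia.
Qed.

(** * The linear form *)

Section Operators.
Variable K : numFieldType.

Definition W : lmodType K := (K^o * {poly K})%type.
(* The pair [(s, f)] stands for the affine combination of a base point, on which
   [vec v] acts as the translation by [v], and of the polynomial [f]. *)
Definition opP (z : W) : W := (0, z.2^`()).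
Definition opQ (z : W) : W := (0, 'X * z.2).
Definition opH (z : W) : W := (0, z.2).
Definition vec (v : {poly K}) (z : W) : W := (0, (z.1 : K) *: v).

(** Eliminating [x], then [ta], leaves the free generators [ada j k v], whose operators can be
    prescribed: only [tz], [tp] and [tq] get nonzero ones. *)
Definition letter_op (v : X) (k j : nat) : W -> W :=
  if Leaf v == Leaf y then
    match k, j with
    | 0%N, 1%N => vec 1
    | 2%N, 0%N => opP
    | 3%N, 0%N => opQ
    | _, _ => fun=> 0
    end
  else fun=> 0.

Definition adx_op (v : X) (k : nat) (g : nat -> W) : nat -> W :=
  if (Leaf v == Leaf y) && (k == 1%N) then g \o succn else leib (letter_op v k) g.

(* The outer sequence index belongs to [x] and the inner one to [a]: at index 0,
   [adx k v] acts by [adx_op v k] and [ada j k v] by [letter_op v k j]. *)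
Definition gen_op (v : X) (F : nat -> nat -> W) : nat -> nat -> W :=
  if Leaf v == Leaf x then F \o succn else leib (adx_op v) F.

Lemma vec_linear v : linear (vec v).
Proof.
move=> k [a f] [b g]; congr (_, _); first by rewrite /= scaler0 addr0.
by rewrite /= scalerDl scalerA.
Qed.

Lemma opP_linear : linear opP.
Proof.
move=> k [a f] [b g]; congr (_, _); first by rewrite /= scaler0 addr0.
by rewrite /= derivD derivZ.
Qed.

Lemma opQ_linear : linear opQ.
Proof.
move=> k [a f] [b g]; congr (_, _); first by rewrite /= scaler0 addr0.
by rewrite /= mulrDr scalerAr.
Qed.

Lemma letter_op_linear v k j : linear (letter_op v k j).
Proof.
have lin0 : linear (fun=> 0 : W) by move=> k' u w; rewrite /= scaler0 addr0.
rewrite /letter_op; case: ifP => // _; case: k => [|[|[|[|k]]]]; case: j => [|[|j]] //.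
- exact: vec_linear.
- exact: opP_linear.
- exact: opQ_linear.
Qed.

Lemma adx_op_linear v k : linear (adx_op v k).
Proof.
move=> c f g; rewrite /adx_op; case: ifP => // _.
by rewrite (leib_linear (letter_op_linear v k)).
Qed.

Lemma gen_op_linear v : linear (gen_op v).
Proof.
by move=> c f g; rewrite /gen_op; case: ifP => // _; rewrite (leib_linear (adx_op_linear v)).
Qed.

Local Notation rho := (rep gen_op).
Local Notation rho_gen := (rep_gen gen_op_linear).
Local Notation rho_bracket := (rep_bracket gen_op_linear).

Lemma rho_x F : rho (ev K (Leaf x)) F = F \o succn.
Proof. by rewrite rho_gen /gen_op eqxx. Qed.

Lemma rho_adx k v F : v <> x -> rho (ev K (adx k v)) F = leib (adx_op v \o addn k) F.
Proof.
move=> vx; elim: k F => [|k IH] F.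
  by rewrite rho_gen /gen_op; case: eqP => // -[].
rewrite /= rho_bracket -/(adx k v) !IH rho_x -/(ev K (Leaf x)) rho_x.
apply/funext => i; rewrite -[LHS]/(leib _ F i.+1 - leib _ (F \o succn) i) leibS addrK.
by congr (leib _ F i); apply/funext => m; rewrite /= addnS.
Qed.

Lemma rho_ta F j : rho (ev K ta) F 0%N j = F 0%N j.+1.
Proof.
rewrite rho_adx; last exact/nesym.
by rewrite leib0 /adx_op /= !eqxx.
Qed.

(** At outer index 0, [ta] shifts the inner index, so [leibS] applies as it did for [x]. *)
Lemma rho_ada j k v F : v <> x -> ~ (v = y /\ k = 1%N) ->
  rho (ev K (ada j k v)) F 0%N = leib (letter_op v k \o addn j) (F 0%N).
Proof.
move=> vx vk; elim: j F => [|j IH] F.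
  rewrite rho_adx // leib0 /= addn0 /adx_op; case: eqP => // -[vy].
  by case: eqP => //= k1; case: vk.
apply/funext => i; rewrite rho_bracket -/(ada j k v).
rewrite -[LHS]/(rho _ _ 0%N i - rho _ _ 0%N i) rho_ta !IH.
have -> : rho (ev K ta) F 0%N = F 0%N \o succn by apply/funext => ?; rewrite rho_ta.
rewrite leibS addrK.
by congr (leib _ _ i); apply/funext => m; rewrite /= addnS.
Qed.

(* The action at index (0, 0) of a Hall tree. The lower bound [tq] on [u] in
   [LocalV] forbids differentiating a positive power of ['X]. *)
Variant local_op : Br X -> (W -> W) -> Prop :=
| LocalZero c : local_op c (fun=> 0)
| LocalP : local_op tp opP
| LocalQ : local_op tq opQ
| LocalH : local_op th opH
| LocalZ : local_op tz (vec 1)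
| LocalV u r i : u = tq \/ u = th -> key (Node u r) = 4%N ->
    local_op (Node u r) (vec 'X^i).

Lemma local_ada j k v : v <> x -> local_op (ada j k v) (letter_op v k j).
Proof.
move=> vx; rewrite /letter_op; case: eqP => [[->]|_]; last exact: LocalZero.
case: k => [|[|[|[|k]]]]; case: j => [|[|j]];
  do ?[exact: LocalZero | exact: LocalZ | exact: LocalP | exact: LocalQ].
Qed.

Lemma local_op0 c E : local_op c E -> E 0 = 0.
Proof.
case=> //= *; rewrite /opP /opQ /vec /= ?deriv0 ?mulr0 ?scale0r //.
Qed.

Lemma key_node4 c1 c2 : key c1 = 3%N -> key c2 = 4%N -> key (Node c1 c2) = 4%N.
Proof.
move=> k1 k2; rewrite keyN k1 k2 eqxx !orbT /=; case: eqP => // -[_ c2y].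
by move: k2; rewrite c2y key_Ly.
Qed.

(** The cases are the commutation rules of d/dt, t, the identity and the translations; the Hall
    condition excludes the brackets that could leave the list. *)
Lemma local_bracket c1 c2 E1 E2 : local_op c1 E1 -> local_op c2 E2 ->
  B (Node c1 c2) -> local_op (Node c1 c2) (fun z => E1 (E2 z) - E2 (E1 z)).
Proof.
move=> L1 L2 [_ _ [lt12 _] lam].
have zero E : E =1 (fun=> 0) -> local_op (Node c1 c2) E.
  by move=> E0; rewrite (funext E0); exact: LocalZero.
have opPvec v z : opP (vec v z) - vec v (opP z) = vec v^`() z.
  by rewrite /opP /vec /= scale0r subr0 derivZ.
have opQvec v z : opQ (vec v z) - vec v (opQ z) = vec ('X * v) z.
  by rewrite /opQ /vec /= scale0r subr0 scalerAr.
have opHvec v z : opH (vec v z) - vec v (opH z) = vec v z.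
  by rewrite /opH /vec /= scale0r subr0.
have vecvec v w z : vec v (vec w z) - vec w (vec v z) = 0.
  by rewrite /vec /= !scale0r subrr.
have hi : key c1 = 4%N -> key c2 = 3%N -> False.
  by move=> k1 k2; have := tle_key lt12; rewrite k1 k2.
(* Such a bracket would differentiate a power of ['X]; it needs [u <= tp]. *)
have lamP u r : u = tq \/ u = th -> c1 = tp -> c2 = Node u r -> False.
  move=> + c1p c2u; rewrite c1p c2u in lam => -[] uE; move: lam; rewrite uE.
    by rewrite /tle key_tp key_tq.
  by rewrite /tle key_tp key_th.
have ltqp : c1 = tq -> c2 = tp -> False.
  by move=> c1q c2p; move: lt12; rewrite c1q c2p /tle key_tp key_tq.
(* Generalized so that the case analyses instantiate these facts too. *)
move: (local_op0 L1) (local_op0 L2) lt12 lam zero hi lamP ltqp.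
case: L1 => [c|||||u r i uqh ku] E10.
- by move=> E20 _ _ zero _ _ _; apply: zero => z; rewrite E20 subrr.
- case: L2 => [c|||||u r i uqh ku] E20 lt12 lam zero hi lamP ltqp.
  + by apply: zero => z; rewrite E10 subrr.
  + by apply: zero => z; rewrite subrr.
  + rewrite (_ : (fun z => _) = opH); first exact: LocalH.
    apply/funext => z; rewrite /opP /opQ /opH; congr (_, _); first by rewrite /= subrr.
    by rewrite /= derivM derivX mul1r addrK.
  + by apply: zero => z; rewrite /opP /opH /= subrr.
  + by apply: zero => z; rewrite opPvec derivC /vec scaler0.
  + by case: (lamP u r).
- case: L2 => [c|||||u r i uqh ku] E20 lt12 lam zero hi lamP ltqp.
  + by apply: zero => z; rewrite E10 subrr.
  + by case: ltqp.
  + by apply: zero => z; rewrite subrr.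
  + by apply: zero => z; rewrite /opQ /opH /= subrr.
  + rewrite (_ : (fun z => _) = vec 'X^1); last first.
      by apply/funext => z; rewrite opQvec mulr1.
    by apply: LocalV; [left | apply: key_node4; [exact: key_tq | exact: key_tz]].
  + rewrite (_ : (fun z => _) = vec 'X^(i.+1)); last first.
      by apply/funext => z; rewrite opQvec exprS.
    by apply: LocalV; [left | apply: key_node4; [exact: key_tq |]].
- case: L2 => [c|||||u r i uqh ku] E20 lt12 lam zero hi lamP ltqp.
  + by apply: zero => z; rewrite E10 subrr.
  + by apply: zero => z; rewrite /opP /opH /= subrr.
  + by apply: zero => z; rewrite /opQ /opH /= subrr.
  + by apply: zero => z; rewrite subrr.
  + rewrite (_ : (fun z => _) = vec 'X^0); last by apply/funext => z; rewrite opHvec.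
    by apply: LocalV; [right | apply: key_node4; [exact: key_th | exact: key_tz]].
  + rewrite (_ : (fun z => _) = vec 'X^i); last by apply/funext => z; rewrite opHvec.
    by apply: LocalV; [right | apply: key_node4; [exact: key_th |]].
- case: L2 => [c|||||u r i uqh ku] E20 lt12 lam zero hi lamP ltqp.
  + by apply: zero => z; rewrite E10 subrr.
  + by case: hi; rewrite ?key_tz ?key_tp.
  + by case: hi; rewrite ?key_tz ?key_tq.
  + by case: hi; rewrite ?key_tz ?key_th.
  + by apply: zero => z; rewrite vecvec.
  + by apply: zero => z; rewrite vecvec.
- case: L2 => [c|||||u' r' i' uqh' ku'] E20 lt12 lam zero hi lamP ltqp.
  + by apply: zero => z; rewrite E10 subrr.
  + by case: hi; rewrite ?key_tp.
  + by case: hi; rewrite ?key_tq.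
  + by case: hi; rewrite ?key_th.
  + by apply: zero => z; rewrite vecvec.
  + by apply: zero => z; rewrite vecvec.
Qed.

(** With left factor [x] or [ta] the tree is some [ada j k v]; otherwise the larger right factor
    also avoids [x] and [ta], and the actions at (0, 0) compose. *)
Lemma local_hall c : B c -> c <> Leaf x -> c <> ta ->
  exists2 E, local_op c E & forall F, rho (ev K c) F 0%N 0%N = E (F 0%N 0%N).
Proof.
elim: c => [v|c1 IH1 c2 IH2] Bc cx ca.
  have [//|j [k [v' [E vx vk]]]] := ada_hall Bc cx ca.
  exists (letter_op v' k j); first by rewrite E; exact: local_ada.
  by move=> F; rewrite E rho_ada // leib0 /= addn0.
have [c1xa|nc1] := pselect (c1 = Leaf x \/ c1 = ta).
  have [//|j [k [v' [E vx vk]]]] := ada_hall Bc cx ca.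
  exists (letter_op v' k j); first by rewrite E; exact: local_ada.
  by move=> F; rewrite E rho_ada // leib0 /= addn0.
have c1x : c1 <> Leaf x by move=> E; apply: nc1; left.
have c1a : c1 <> ta by move=> E; apply: nc1; right.
have [Bc1 Bc2 [/tle_key k12 _] _] := Bc.
have k2 := leq_trans (key_neq_xa c1x c1a) k12.
have c2x : c2 <> Leaf x by move=> E; rewrite E key_Lx in k2.
have c2a : c2 <> ta by move=> E; rewrite E key_ta in k2.
have [E1 L1 R1] := IH1 Bc1 c1x c1a; have [E2 L2 R2] := IH2 Bc2 c2x c2a.
exists (fun z => E1 (E2 z) - E2 (E1 z)); first exact: local_bracket.
by move=> F; rewrite rho_bracket -R1 -R2 -R1 -R2.
Qed.

Definition phi (u : free_lie K X) : K := (rho u (fun _ _ => (1, 0)) 0%N 0%N).2.[1].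

Lemma phiD u w : phi (u + w) = phi u + phi w.
Proof. by rewrite /phi (repD gen_op_linear) -hornerD. Qed.

Lemma phiZ k u : phi (k *: u) = k * phi u.
Proof. by rewrite /phi (repZ gen_op_linear) -hornerZ. Qed.

(** [x] and [ta] shift the constant test vector, [opP], [opQ] and [opH] kill its value [(1, 0)], and
    monomials are 1 at t = 1. *)
Lemma phi_le1 c : B c -> `|phi (ev K c)| <= 1.
Proof.
move=> Bc; rewrite /phi.
have [->|cx] := pselect (c = Leaf x); first by rewrite rho_x horner0 normr0.
have [->|ca] := pselect (c = ta); first by rewrite rho_ta horner0 normr0.
have [E L ->] := local_hall Bc cx ca.
case: L => [c'|||||u r i _ _]; rewrite /opP /opQ /opH /vec /= ?deriv0 ?mulr0 ?scale1r.
- by rewrite horner0 normr0.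
- by rewrite horner0 normr0.
- by rewrite horner0 normr0.
- by rewrite horner0 normr0.
- by rewrite hornerC normr1.
- by rewrite hornerXn expr1n normr1.
Qed.

(** In [[ta, w]] the shift [ta] reads inner index 1, hence the two indices; a letter [c] on the
    right replaces the translation by its commutator with [E]. *)
Lemma rho_word_step (w c : Br X) (v v' : {poly K}) (E : W -> W) :
  (forall F, rho (ev K w) F 0%N 0%N = 0 /\ rho (ev K w) F 0%N 1%N = vec v (F 0%N 0%N)) ->
  (forall F j, (j < 2)%N -> rho (ev K c) F 0%N j = E (F 0%N j)) ->
  E 0 = 0 -> (forall z, vec v (E z) - E (vec v z) = vec v' z) ->
  forall F, rho (ev K (Node w c)) F 0%N 0%N = 0 /\
    rho (ev K (Node w c)) F 0%N 1%N = vec v' (F 0%N 0%N).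
Proof.
move=> Rw Rc E0 EE F; rewrite rho_bracket.
rewrite -[X in X = 0]/(rho _ _ 0%N 0%N - rho _ _ 0%N 0%N).
rewrite -[X in _ /\ X = _]/(rho _ _ 0%N 1%N - rho _ _ 0%N 1%N).
by rewrite !Rc // !(Rw _).1 !(Rw _).2 Rc // E0 subrr EE.
Qed.

(** [letter_op y k 1] is 0 for these [k], so one term of the Leibniz sum survives. *)
Lemma rho_adx_pointwise k E F j : k = 2%N \/ k = 3%N -> letter_op y k 0 = E ->
  (j < 2)%N -> rho (ev K (adx k y)) F 0%N j = E (F 0%N j).
Proof.
move=> k23 <- j2; rewrite rho_adx; last exact/nesym.
rewrite leib0 /= addn0 /adx_op eqxx /=.
case: k23 => ->; case: j j2 => [|[|//]] _ /=; rewrite ?leibS !leib0 /=.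
all: by rewrite /letter_op eqxx ?add0r.
Qed.

(** Letters stand on the right of the brackets, hence the signs: [tq] multiplies by [- 'X], [tp]
    acts as - d/dt. *)
Lemma rho_word i l F : rho (ev K (word i l)) F 0%N 0%N = 0 /\
  rho (ev K (word i l)) F 0%N 1%N =
    vec ((-1) ^+ (i + l) *: ('X^i)^`(l)) (F 0%N 0%N).
Proof.
elim: l F => [|l IH].
  elim: i => [|i IH] F.
    have := rho_ada 0%N (k := 0%N) F (nesym xy); rewrite /ada /=.
    move=> -> //; last by case.
    rewrite leibS !leib0 /letter_op eqxx /= addr0; split=> //.
    by rewrite expr0 scale1r.
  apply: (rho_word_step (c := tq) (E := opQ) IH) => [G j j2||z].
  - by apply: rho_adx_pointwise => //; [right | rewrite /letter_op eqxx].
  - by rewrite /opQ /= mulr0.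
  - rewrite -opprB /vec /opQ /= scale0r subr0 /= !addn0 [(-1) ^+ i.+1]exprS mulN1r.
    congr (_, _); first by rewrite /= oppr0.
    by rewrite /= scaleNr scalerN exprS -!scalerAr.
move=> F; apply: (rho_word_step (c := tp) (E := opP) IH) => [G j j2||z].
- by apply: rho_adx_pointwise => //; [left | rewrite /letter_op eqxx].
- by rewrite /opP /= deriv0.
- rewrite -opprB /vec /opP /= scale0r subr0 /= addnS [(-1) ^+ _.+1]exprS mulN1r.
  congr (_, _); first by rewrite /= oppr0.
  by rewrite /= scaleNr scalerN !derivZ.
Qed.

(** At t = 1 the [l]-th derivative of t^i is [l!] times a positive binomial coefficient. *)
Lemma phi_bracket_word i l : (l <= i)%N ->
  (l`!)%:R <= `|phi (bracket (ev K ta) (ev K (word i l)))|.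
Proof.
move=> li; rewrite /phi rho_bracket.
rewrite -[(_ - _) _ _]/(rho _ _ 0%N 0%N - rho _ _ 0%N 0%N).
rewrite rho_ta (rho_word _ _ _).1 (rho_word _ _ _).2 subr0 /vec /= scale1r.
rewrite hornerZ normrM normrX normrN1 expr1n mul1r derivnXn hornerMn hornerXn expr1n.
rewrite ger0_norm // ler_nat -(bin_ffact i l) leq_pmull // bin_gt0 //.
Qed.

End Operators.
End KeyOrder.

(** * Choice of the exponents and conclusion *)

Lemma expn_le_fact (d k : nat) : (d ^ k <= (d + k)`!)%N.
Proof.
elim: k => [|k IH]; first by rewrite addn0 fact_gt0.
by rewrite addnS factS expnS leq_mul // ltnW // ltnS leq_addr.
Qed.

Lemma superexponential_split (m : nat) : exists N : nat, forall n, (N <= n)%N ->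
  exists i l, [/\ (l <= i)%N, (1 + 4 * i + 3 * l)%N = n & (m ^ n <= l`!)%N].
Proof.
(* [l] grows like [n / 7]; at most half of it is lost to [d], and half of the exponent 16 exceeds
   7. *)
pose d := (m.+1 ^ 16)%N; exists (22 + 28 * (49 + 2 * d))%N => n Nn.
(* 3 is its own inverse modulo 4, which gives [3 * l = n - 1] there; the division by 28 yields
   [7 * l <= n - 1], that is [l <= i]. *)
pose q := ((n - 22) %/ 28)%N; pose l := (4 * q + (3 * (n - 1)) %% 4)%N.
exists ((n - 1 - 3 * l) %/ 4)%N, l.
have [li lE nl] : [/\ (7 * l <= n - 1)%N, (3 * l = n - 1 %[mod 4])%N & (n <= 7 * l + 49)%N].
  by rewrite /l /q; split; lia.
have ld : (49 + 2 * d <= l)%N by rewrite /l /q; lia.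
split; [lia | lia |].
apply: (@leq_trans (m.+1 ^ n)); first by rewrite leq_exp2r //; lia.
apply: (@leq_trans (d ^ (l - d))); last first.
  by apply: leq_trans (expn_le_fact _ _) _; rewrite subnKC //; lia.
by rewrite {1}/d -expnM leq_pexp2l //; clearbody d; lia.
Qed.

Lemma base_field_archi (R : realType) (k : field_kind) (M : base_field R k) :
  1 <= M -> exists m : nat, M <= m%:R.
Proof.
case: k M => /= [M M1|[a b]].
  exists (Num.bound M); apply: ltW; apply: archi_boundP.
  exact: le_trans ler01 M1.
rewrite lecE /= => /andP[/eqP b0 a1].
exists (Num.bound a).
rewrite -(rmorph_nat (real_complex R)) lecE /= b0 eqxx /=.
by apply: ltW; apply: archi_boundP; exact: le_trans ler01 a1.
Qed.

(* In the order of R[i], 1 <= M says that M is real and at least 1. *)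
Theorem theorem1p8 (R : realType) (k : field_kind) (X : Type)
    (hX : exists x y : X, x <> y) :
  exists (B : set (Br X)) (le : Br X -> Br X -> Prop),
    hall_set B le /\
    forall M : base_field R k, 1 <= M ->
      exists N : nat, forall n : nat, (0 < n)%N -> (N <= n)%N ->
        exists a b : Br X,
          [/\ B a, B b, strict le a b, leaves a = 2%N & leaves b = n] /\
          M ^+ n <= hall_norm B (bracket (ev (base_field R k) a)
                                         (ev (base_field R k) b)).
Proof.
have [x [y xy]] := hX.
have [wo [wo_total wo_anti wo_trans]] := total_order_exists (Br X).
pose le : rel (Br X) := tle x y wo.
have hB : hall_set (hall_trees le) le by exact: hall_B.
exists (hall_trees le), le; split=> // M M1.
have [m Mm] := base_field_archi M1; have [N HN] := superexponential_split m.
exists N => n _ /HN[i [l [li nE ml]]]; exists (ta x y), (word x y i l).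
have Ba : hall_trees le (ta x y) by exact: (B_adx xy wo_total 1).
have [Bw kw] : hall_trees le (word x y i l) /\ key x y (word x y i l) = 2%N.
  exact: word_hall.
have ab : strict le (ta x y) (word x y i l) by apply: key_lt; rewrite key_ta kw.
split; first by split=> //; rewrite leaves_word.
apply: (@le_trans _ _ (l`!)%:R).
  apply: (@le_trans _ _ (m%:R ^+ n)); last by rewrite -natrX ler_nat.
  by apply: lerXn2r => //; rewrite nnegrE ?ler0n // (le_trans ler01 M1).
apply: le_trans (phi_bracket_word xy _ li) _.
apply: le_hall_norm (hall_span_bracket _ hB Ba Bw ab) => //.
- exact: phiD.
- exact: phiZ.
- by move=> c; exact: phi_le1.
Qed.
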